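(* Let $W$ be a random variable with $EW=0$ and $\mathrm{Var}(W)=1$, with distribution function $F$, and let $W^*$ be a random variable that has the $W$-zero biased distribution and is defined on the same probability space as $W$. Then, with $\Phi$ the cumulative distribution function of the standard normal distribution, $$\|F-\Phi\|_1\le 2E|W^*-W|.$$
   Context: For distribution functions $F,G$ on $\mathbf{R}$, $\|F-G\|_1=\int_{-\infty}^\infty|F(t)-G(t)|\,dt$. Zero biased distribution: for a mean zero random variable $W$ with finite variance $\sigma^2$, a random variable $W^*$ has the $W$-zero biased distribution if $E[Wf(W)]=\sigma^2E[f'(W^* )]$ for all absolutely continuous $f$ with $E|Wf(W)|<\infty$ and $E|f'(W^* )|<\infty$. Such a $W^*$ exists for every such $W$; for $\sigma^2>0$ its distribution is absolutely continuous with density $x\mapsto -\sigma^{-2}E[W\mathbf{1}(W\le x)]$. No particular joint distribution of $(W,W^* )$ is assumed. *)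

(* Defs.v *)
From mathcomp Require Import all_boot all_order all_algebra.
From mathcomp Require Import all_classical all_reals all_analysis.

Set Implicit Arguments.
Unset Strict Implicit.
Unset Printing Implicit Defensive.

Import Order.TTheory GRing.Theory Num.Theory.
Import numFieldNormedType.Exports.

Local Open Scope classical_set_scope.
Local Open Scope ring_scope.

Definition abs_continuous_on (R : realType) (a b : R) (f : R -> R) : Prop :=
  forall e : R, 0 < e -> exists2 delta : R, 0 < delta &
    forall (n : nat) (x y : 'I_n -> R),
      (forall i, a <= x i /\ x i <= y i /\ y i <= b) ->
      trivIset [set: 'I_n] (fun i => `]x i, y i[%classic) ->
      \sum_(i < n) (y i - x i) < delta ->
      \sum_(i < n) `|f (y i) - f (x i)| < e.

(* For a function on the whole line, absolute continuity is required on every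
   compact interval, so that e.g. polynomials qualify. *)
Definition abs_continuous (R : realType) (f : R -> R) : Prop :=
  forall a b : R, abs_continuous_on a b f.

Local Open Scope ereal_scope.

(* [derive1 f] is total: the derivative where it exists (almost everywhere for
   absolutely continuous f) and a default value elsewhere. When Var(W) > 0 the
   default is immaterial, as the zero biased law has a Lebesgue density.
   W and Ws may live on different probability spaces; only the law of Ws
   matters. *)
Definition zero_biased (R : realType)
    (d : measure_display) (T : measurableType d) (P : probability T R)
    (d' : measure_display) (T' : measurableType d') (P' : probability T' R)
    (W : {RV P >-> R}) (Ws : {RV P' >-> R}) : Prop :=
  forall f : R -> R, abs_continuous f ->
    P.-integrable [set: T] (fun w => (W w * f (W w))%:E) ->
    P'.-integrable [set: T'] (fun w => (derive1 f (Ws w))%:E) ->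
    'E_P[fun w => (W w * f (W w))%R] =
      'V_P[W] * 'E_P'[fun w => derive1 f (Ws w)].

Definition L1_dist (R : realType) (F G : R -> \bar R) : \bar R :=
  \int[lebesgue_measure]_t `|F t - G t|.

Definition std_normal_cdf (R : realType) (t : R) : \bar R :=
  normal_prob (0 : R) (1 : R) `]-oo, t].

(* Main.v *)
(** Let [f_t] be the bounded solution of Stein's equation
    [f'(x) = x f(x) + 1(x <= t) - Phi(t)]. Zero biasing gives
    [F(t) - Phi(t) = E[f_t'(W) - f_t'(Ws)]] for every [t] that is not an atom of
    [Ws], that is, for almost every [t]. Since [x f_t(x)] is nondecreasing in [x]
    and the integral of [f_t(x)] over [t] is [1] for each [x], the integral over
    [t] of [|x f_t(x) - y f_t(y)|] is exactly [|x - y|]; the jump [1(x <= t)]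
    contributes another [|x - y|]. Tonelli's theorem then concludes. *)

From HB Require Import structures.
Require Import Defs.
From mathcomp Require Import all_boot all_order all_algebra.
From mathcomp Require Import all_classical all_reals all_analysis.
From mathcomp Require Import measurable_realfun ring lra.

Import Order.TTheory GRing.Theory Num.Theory.
Import numFieldNormedType.Exports.

Local Open Scope classical_set_scope.
Local Open Scope ring_scope.

(** * Consequences of the mean value theorem *)

Lemma ndecr_is_derive (R : realType) (f f' : R -> R) (a b : R) : a <= b ->
  (forall x, x <= b -> is_derive x 1 f (f' x)) ->
  (forall x, x <= b -> 0 <= f' x) -> f a <= f b.
Proof.
move=> ab df f'0; rewrite -subr_ge0.
have [||c] := @MVT_segment R f f' a b ab.
- by move=> x; rewrite in_itv/= => /andP[_ /ltW]; exact: df.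
- apply: derivable_within_continuous => x.
  by rewrite in_itv/= => /andP[_ xb]; case: (df x xb).
- by rewrite in_itv/= => /andP[_ cb] ->; rewrite mulr_ge0 ?subr_ge0// f'0.
Qed.

(** The bound on [f'] is asked only strictly inside, since in [stein_lipschitz] it has to hold for a
    branch of [stein t] that may end at the corner [t]. *)
Lemma lipschitz_is_derive (R : realType) (f f' : R -> R) (k a b : R) : a <= b ->
  (forall x, a <= x <= b -> is_derive x 1 f (f' x)) ->
  (forall x, a < x < b -> `|f' x| <= k) -> `|f b - f a| <= k * (b - a).
Proof.
rewrite le_eqVlt => /predU1P[->|ab] df f'k; first by rewrite !subrr normr0 mulr0.
have [||c] := @MVT R f f' a b ab.
- by move=> x; rewrite in_itv/= => /andP[/ltW ax /ltW xb]; apply: df; rewrite ax.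
- apply: derivable_within_continuous => x.
  by rewrite in_itv/= => xab; case: (df x xab).
- rewrite in_itv/= => cab ->; rewrite normrM (@ger0_norm _ (b - a)).
    by rewrite ler_wpM2r ?f'k// subr_ge0 ltW.
  by rewrite subr_ge0 ltW.
Qed.

(** If [f b] were negative, the limit [0] would force [f x > f b] for some [x <= b], against
    monotonicity. Used below to prove tail inequalities by differentiating the difference of their
    sides. *)
Lemma ge0_is_derive_cvgNy (R : realType) (f f' : R -> R) (b : R) :
  (forall x, x <= b -> is_derive x 1 f (f' x)) ->
  (forall x, x <= b -> 0 <= f' x) -> f x @[x --> -oo] --> 0 -> 0 <= f b.
Proof.
move=> df f'0 f0; rewrite leNgt; apply/negP => fb.
have : \forall x \near -oo, f b < f x by apply: cvgr_gt f0 _ _.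
move/(filterI (nbhs_ninfty_le (num_real b))) => /filter_ex[x /= [xb]].
rewrite ltNge => /negP; apply; exact: (@ndecr_is_derive _ f f').
Qed.

(** * The standard normal density and distribution function *)

Section std_normal.
Context {R : realType}.
Implicit Types x t : R.
Local Notation mu := (@lebesgue_measure R).

Definition phi x : R := normal_pdf 0 1 x.

Definition Phi x : R := fine (@std_normal_cdf R x).

Lemma phiE x : phi x = normal_peak 1 * expR (- x ^+ 2 / 2).
Proof.
by rewrite /phi normal_pdfE ?oner_neq0// /normal_fun subr0 expr1n.
Qed.

Lemma phi_gt0 x : 0 < phi x.
Proof. by rewrite phiE mulr_gt0 ?expR_gt0 ?normal_peak_gt0 ?oner_neq0. Qed.

Lemma phi_neq0 x : phi x != 0.
Proof. by rewrite gt_eqF ?phi_gt0. Qed.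

Lemma phiN x : phi (- x) = phi x.
Proof. by rewrite !phiE sqrrN. Qed.

Lemma is_derive_phi x : is_derive x 1 phi (- x * phi x).
Proof.
have dq : is_derive x 1 (fun y : R => - y ^+ 2 / 2) (- x).
  have := is_deriveM (is_deriveN (is_deriveX 2 (is_derive_id x 1)))
    (is_derive_cst (2^-1 : R) x 1).
  by move=> /is_derive_eq; apply; rewrite /GRing.scale/=; field.
have -> : phi = normal_peak 1 \*: (fun y => expR (- y ^+ 2 / 2)).
  by apply/funext => y; exact: phiE.
have := is_deriveZ (normal_peak 1) (is_derive1_comp (is_derive_expR _) dq).
by move=> /is_derive_eq; apply; rewrite /GRing.scale/= /GRing.scale/=; ring.
Qed.

Lemma continuous_phi : continuous phi.
Proof. by apply: continuous_normal_pdf; rewrite oner_neq0. Qed.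

(* Completing the square gives [- x ^ 2 / 2 <= x + 1 / 2]. *)
Lemma phi_cvgNy : phi x @[x --> -oo] --> 0.
Proof.
pose c := normal_peak 1 * expR (2^-1) : R.
have c0 : c * expR x @[x --> -oo] --> 0.
  rewrite -(mulr0 c); apply: cvgMr.
  by apply/cvgNy_compNP; exact: cvgr_expR.
apply: squeeze_cvgr (@cvg_cst _ 0 _ _ _) c0.
near=> x; rewrite ltW ?phi_gt0//= phiE -mulrA -expRD ler_wpM2l ?normal_peak_ge0//.
by rewrite ler_expR; have := sqr_ge0 (x + 1); lra.
Unshelve. all: by end_near. Qed.

Lemma PhiE x : @std_normal_cdf R x = (Phi x)%:E.
Proof. by rewrite /Phi fineK// fin_num_measure. Qed.

Lemma Phi_ge0 x : 0 <= Phi x.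
Proof. by rewrite -lee_fin -PhiE. Qed.

Lemma Phi_le1 x : Phi x <= 1.
Proof. by rewrite -lee_fin -PhiE probability_le1. Qed.

Lemma is_derive_Phi x : is_derive x 1 Phi (phi x).
Proof.
have [||||] := @continuous_FTC1 R phi -oo%O x (x + 1).
- by rewrite ltrDl.
- by apply: integrableS (integrable_normal_pdf 0 1).
- by rewrite ltNyr.
- exact: continuous_phi.
move=> dF dFE; have -> : Phi = fun y => \int[mu]_(t in `]-oo, y]) phi t by [].
by split; [exact: dF|rewrite -derive1E].
Qed.

(** Under the normal law the identity is a random variable with cdf [std_normal_cdf], so the limits
    of [Phi] are those of a cdf. *)
Let idR : measurableTypeR R -> R := idfun.

#[local] HB.instance Definition _ :=
  @isMeasurableFun.Build _ _ _ _ idR (@measurable_id _ _ setT).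

Lemma Phi_cvgNy : Phi x @[x --> -oo] --> 0.
Proof. exact: fine_cvg (cvg_cdfNy0 (idR : {RV normal_prob 0 1 >-> R})). Qed.

Lemma Phi_cvgy : Phi x @[x --> +oo] --> (1 : R).
Proof. exact: fine_cvg (cvg_cdfy1 (idR : {RV normal_prob 0 1 >-> R})). Qed.

(** Since [phi] is even, [Phi y + Phi (- y)] has derivative [0]; its limit at [+oo] identifies the
    constant as [1]. *)
Lemma PhiN x : Phi (- x) = 1 - Phi x.
Proof.
pose S y := Phi y + Phi (- y).
have dS (y : R) : is_derive y 1 S 0.
  have dN : is_derive y 1 (fun z : R => Phi (- z)) (- phi y).
    have := is_derive1_comp (is_derive_Phi (- y)) (is_deriveN (is_derive_id y 1)).
    by move=> /is_derive_eq; apply; rewrite phiN mulrN1.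
  by have := is_deriveD (is_derive_Phi y) dN; rewrite subrr.
have S_cst y z : S y = S z.
  wlog yz : y z / y <= z => [H|].
    by case: (leP y z) => [|/ltW] /H.
  have [|c] := @MVT_segment R S (cst 0) y z yz (fun t _ => dS t).
  - by apply: derivable_within_continuous => t _; case: (dS t).
  - by rewrite mul0r => _ /eqP; rewrite subr_eq0 => /eqP.
have S1 : S y @[y --> +oo] --> (1 : R).
  rewrite -[X in _ --> X](addr0 (1 : R)); apply: cvgD Phi_cvgy _.
  by apply/(cvgNy_compNP Phi); exact: Phi_cvgNy.
have : S y @[y --> +oo] --> S x by rewrite (funext (S_cst ^~ x)); exact: cvg_cst.
move=> /(cvg_unique (@Rhausdorff R) S1) ->.
by rewrite /S addrAC subrr add0r.
Qed.

End std_normal.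

(** * Mills ratio inequalities *)

Section mills.
Context {R : realType}.
Implicit Types x t : R.

(** The Mills ratio of the lower tail; the classical ratio [(1 - Phi x) / phi x] is
    [mills (- x)]. *)
Definition mills x : R := Phi x / phi x.

Lemma mills_ge0 x : 0 <= mills x.
Proof. by rewrite divr_ge0 ?Phi_ge0// ltW ?phi_gt0. Qed.

Lemma millsK x : mills x * phi x = Phi x.
Proof. by rewrite divfK ?phi_neq0. Qed.

Lemma is_derive_mills x : is_derive x 1 mills (1 + x * mills x).
Proof.
have := is_deriveM (is_derive_Phi x) (is_deriveV (phi_neq0 x) (is_derive_phi x)).
move=> /is_derive_eq; apply; rewrite /mills /GRing.scale/=.
by field; exact: phi_neq0.
Qed.

Lemma Phi_nondecreasing : {homo @Phi R : x y / x <= y}.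
Proof.
move=> x y xy; apply: (@ndecr_is_derive _ Phi phi) => // z _.
- exact: is_derive_Phi.
- by rewrite ltW ?phi_gt0.
Qed.

(* The witness [Phi y + y * phi y / (1 + y ^ 2)] is nondecreasing, with limit [0]
   at [-oo]; the right-hand side is the derivative of [x * mills x]. *)
Lemma mills_lower x : 0 <= mills x + x * (1 + x * mills x).
Proof.
pose r x := x / (1 + x ^+ 2) : R.
have den (y : R) : 1 + y ^+ 2 != 0 by rewrite gt_eqF// ltr_pwDl ?sqr_ge0.
pose D y := Phi y + r y * phi y.
have dD (y : R) : is_derive y 1 D (2 * phi y / (1 + y ^+ 2) ^+ 2).
  have dden : is_derive y 1 (fun z : R => 1 + z ^+ 2) (2 * y).
    have := is_deriveD (is_derive_cst (1 : R) y 1) (is_deriveX 2 (is_derive_id y 1)).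
    by move=> /is_derive_eq; apply; rewrite /GRing.scale/=; ring.
  have := is_deriveD (is_derive_Phi y) (is_deriveM (is_deriveM (is_derive_id y 1)
    (@is_deriveV _ (fun z => 1 + z ^+ 2) _ _ _ (den y) dden)) (is_derive_phi y)).
  move=> /is_derive_eq; apply; rewrite /GRing.scale/=.
  by rewrite /GRing.scale/= !fctE; field; rewrite den.
have rle y : `|r y| <= 1.
  rewrite normrM normfV ler_pdivrMr ?normr_gt0// mul1r.
  rewrite (@ger0_norm _ (1 + y ^+ 2)) ?addr_ge0 ?sqr_ge0//.
  rewrite -(real_normK (num_real y)); have := sqr_ge0 (`|y| - 1).
  by have := normr_ge0 y; lra.
have D0 : D y @[y --> -oo] --> (0 : R).
  rewrite -[X in _ --> X](addr0 (0 : R)); apply: cvgD Phi_cvgNy _.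
  apply/norm_cvg0P; apply: squeeze_cvgr (@cvg_cst _ 0 _ _ _) phi_cvgNy.
  near=> y; rewrite normr_ge0/= normrM (gtr0_norm (phi_gt0 y)).
  by rewrite ler_piMl// ltW ?phi_gt0.
have : 0 <= D x.
  apply: ge0_is_derive_cvgNy D0 => y _ //.
  by rewrite divr_ge0 ?sqr_ge0 ?mulr_ge0// ltW ?phi_gt0.
rewrite /D -millsK -mulrDl pmulr_lge0 ?phi_gt0//.
rewrite -(pmulr_lge0 _ (_ : 0 < 1 + x ^+ 2)) ?ltr_pwDl ?sqr_ge0//.
by rewrite mulrDl /r divfK ?den//; congr (_ <= _); ring.
Unshelve. all: by end_near. Qed.

(** For [x < 0] this is the tail bound [Phi x <= - phi x / x]. The difference [q] of its two sides
    has derivative [phi y / y ^ 2] and limit [0] at [-oo], hence is nonnegative. *)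
Lemma mills_upper x : -1 <= x * mills x.
Proof.
have [x0|x0] := leP 0 x.
  by rewrite (@le_trans _ _ 0)// mulr_ge0 ?mills_ge0.
pose q (y : R) := - (phi y / y) - Phi y.
have dq (y : R) : y <= x -> is_derive y 1 q (phi y / y ^+ 2).
  move=> yx; have y0 : y != 0 by rewrite lt_eqF// (le_lt_trans yx).
  have := is_deriveB (is_deriveN (is_deriveM (is_derive_phi y)
    (is_deriveV y0 (is_derive_id y 1)))) (is_derive_Phi y).
  move=> /is_derive_eq; apply; rewrite /GRing.scale/=.
  by rewrite /GRing.scale/=; field.
have q0 : q y @[y --> -oo] --> (0 : R).
  rewrite -[X in _ --> X](subr0 (0 : R)); apply: cvgB _ Phi_cvgNy.
  apply/norm_cvg0P; apply: squeeze_cvgr (@cvg_cst _ 0 _ _ _) phi_cvgNy.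
  near=> y.
  have y1 : y <= -1 by near: y; apply: nbhs_ninfty_le; exact: num_real.
  have yN0 : y < 0 by rewrite (le_lt_trans y1)// ltrN10.
  rewrite normr_ge0/= normrN normrM (gtr0_norm (phi_gt0 y)).
  apply: ler_piMr; first by rewrite ltW ?phi_gt0.
  by rewrite normfV invf_le1 ?normr_gt0 ?lt_eqF// ltr0_norm// lerNr.
have : 0 <= q x.
  apply: ge0_is_derive_cvgNy q0 => y // _.
  by rewrite divr_ge0 ?sqr_ge0// ltW ?phi_gt0.
rewrite /q subr_ge0 => /(ler_wnM2l (ltW x0)).
rewrite mulrN mulrCA divff ?lt_eqF// mulr1.
by rewrite /mills mulrA ler_pdivlMr ?phi_gt0// mulN1r.
Unshelve. all: by end_near. Qed.

Lemma mul_mills_nondecreasing : {homo (fun x => x * mills x) : x y / x <= y}.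
Proof.
move=> x y xy.
apply: (@ndecr_is_derive _ (fun x => x * mills x)
  (fun x => mills x + x * (1 + x * mills x))) => // z _.
  have := is_deriveM (is_derive_id z 1) (is_derive_mills z).
  by move=> /is_derive_eq; apply; rewrite /GRing.scale/=; ring.
exact: mills_lower.
Qed.

(** * The Stein solution: branches, monotonicity and bounds *)

Lemma millsN x : mills (- x) = (1 - Phi x) / phi x.
Proof. by rewrite /mills PhiN phiN. Qed.

(* The solution of Stein's equation for the indicator of [`]-oo, t]]. *)
Definition stein t x : R :=
  Phi (Num.min t x) * (1 - Phi (Num.max t x)) / phi x.

Lemma stein_le t x : x <= t -> stein t x = (1 - Phi t) * mills x.
Proof.
by move=> xt; rewrite /stein min_r// max_l// /mills mulrAC mulrC.
Qed.

Lemma stein_ge t x : t <= x -> stein t x = Phi t * mills (- x).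
Proof. by move=> tx; rewrite /stein min_l// max_r// millsN mulrA. Qed.

Lemma stein_ge0 t x : 0 <= stein t x.
Proof.
by rewrite divr_ge0 ?mulr_ge0 ?Phi_ge0 ?subr_ge0 ?Phi_le1// ltW ?phi_gt0.
Qed.

(** Left of [t] the function is a nonnegative multiple of [x * mills x]; right of [t] it is one of
    [- (- x * mills (- x))], which is nondecreasing because both signs reverse. The two pieces agree
    at [t]. *)
Lemma mul_stein_nondecreasing t : {homo (fun x => x * stein t x) : x y / x <= y}.
Proof.
have lhs x y : x <= y -> y <= t -> x * stein t x <= y * stein t y.
  move=> xy yt; rewrite !stein_le// ?(le_trans xy)// !(mulrCA _ (1 - Phi t)).
  by rewrite ler_wpM2l ?subr_ge0 ?Phi_le1// mul_mills_nondecreasing.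
have rhs x y : t <= x -> x <= y -> x * stein t x <= y * stein t y.
  move=> tx xy; rewrite !stein_ge// ?(le_trans tx)// !(mulrCA _ (Phi t)).
  rewrite ler_wpM2l ?Phi_ge0// -lerN2 -!mulNr.
  by apply: mul_mills_nondecreasing; rewrite lerN2.
move=> x y xy; have [yt|/ltW ty] := leP y t; first exact: lhs.
have [xt|/ltW tx] := leP x t; last exact: rhs.
exact: le_trans (lhs _ _ xt (lexx t)) (rhs _ _ (lexx t) ty).
Qed.

Lemma mul_stein_bound t x : `|x * stein t x| <= 1.
Proof.
wlog x0 : t x / 0 <= x => [H|].
  have [|/ltW x0] := leP 0 x; first exact: H.
  (* The reflection [stein t x = stein (- t) (- x)] reduces negative [x] to positive [x]. *)
  have -> : x * stein t x = - (- x * stein (- t) (- x)).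
    rewrite mulNr opprK /stein -oppr_min -oppr_max !PhiN phiN.
    by congr (_ * (_ / _)); rewrite mulrC subKr.
  by rewrite normrN H// oppr_ge0.
rewrite (ger0_norm (mulr_ge0 x0 (stein_ge0 t x))).
(* Bounding [Phi (min t x)] by [1] and [Phi (max t x)] below by [Phi x] removes [t]; [mills_upper]
   at [- x] then bounds the rest by [1]. *)
apply: (@le_trans _ _ (x * mills (- x))).
  rewrite millsN ler_wpM2l// /stein ler_wpM2r ?invr_ge0 ?(ltW (phi_gt0 _))//.
  rewrite (@le_trans _ _ (1 - Phi (Num.max t x)))//.
    by rewrite ler_piMl ?Phi_le1// subr_ge0 Phi_le1.
  by rewrite lerB// Phi_nondecreasing// le_max lexx orbT.
by rewrite -lerN2 -mulNr; exact: mills_upper.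
Qed.

End mills.

(** * Integrating the Stein solution over its parameter *)

Section stein_integral.
Context {R : realType}.
Implicit Types x t : R.
Local Notation mu := (@lebesgue_measure R).

Lemma continuous_Phi : continuous (@Phi R).
Proof.
by move=> x; apply/differentiable_continuous/derivable1_diffP; case: (is_derive_Phi x).
Qed.

Lemma measurable_Phi : measurable_fun setT (@Phi R).
Proof. exact: continuous_measurable_fun continuous_Phi. Qed.

(** Tonelli's theorem needs joint measurability; the min/max form of [stein] yields it with no case
    split. *)
Lemma measurable_stein :
  measurable_fun setT (fun p : R * R => stein p.1 p.2).
Proof.
have mV : measurable_fun setT (fun x : R => (phi x)^-1).
  apply: continuous_measurable_fun => x.
  by apply: cvgV; [exact: phi_neq0|exact: continuous_phi].
apply: measurable_funM.
  apply: measurable_funM.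
    apply: (measurableT_comp measurable_Phi).
    exact: measurable_minr.
  apply: measurable_funB => //.
  apply: (measurableT_comp measurable_Phi).
  exact: measurable_maxr.
exact: (measurableT_comp mV).
Qed.

(** The antiderivative [t * (1 - Phi t) - phi t] vanishes at [+oo]: by [mills_upper],
    [t * (1 - Phi t)] lies between [0] and [phi t] for [t >= 0]. *)
Lemma integral_Phi_tail x :
  (\int[mu]_(t in `[x, +oo[) (1 - Phi t)%:E = (phi x - x * (1 - Phi x))%:E)%E.
Proof.
pose F t := t * (1 - Phi t) - phi t.
have dF (t : R) : is_derive t 1 F (1 - Phi t).
  have := is_deriveB (is_deriveM (is_derive_id t 1)
    (is_deriveB (is_derive_cst (1 : R) t 1) (is_derive_Phi t))) (is_derive_phi t).
  move=> /is_derive_eq; apply; rewrite /GRing.scale/=.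
  by rewrite !fctE /=; ring.
have phiy : phi t @[t --> +oo] --> (0 : R).
  apply/cvgy_compNP; rewrite (_ : _ \o _ = @phi R).
    exact: phi_cvgNy.
  by apply/funext => t /=; rewrite phiN.
have Fy : F t @[t --> +oo] --> (0 : R).
  rewrite -[X in _ --> X](subr0 (0 : R)); apply: cvgB (phiy).
  apply: squeeze_cvgr (@cvg_cst _ 0 _ _ _) phiy.
  near=> t.
  have t0 : 0 <= t by near: t; apply: nbhs_pinfty_ge; exact: num_real.
  rewrite mulr_ge0 ?subr_ge0 ?Phi_le1//=.
  rewrite -PhiN -millsK phiN mulrA ler_piMl ?(ltW (phi_gt0 t))//.
  by rewrite -lerN2 -mulNr; exact: mills_upper.
have cF : continuous F.
  by move=> t; apply/differentiable_continuous/derivable1_diffP; case: (dF t).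
have cG : continuous (fun t : R => 1 - Phi t).
  by move=> t; apply: cvgB; [exact: cvg_cst|exact: continuous_Phi].
rewrite (@ge0_continuous_FTC2y _ (fun t => 1 - Phi t) F x 0)//.
- by rewrite /F -EFinB sub0r opprB.
- by move=> t _; rewrite subr_ge0 Phi_le1.
- exact: continuous_subspaceT.
- exact/cvg_at_right_filter/cF.
- by move=> t _; rewrite derive1E; case: (dF t).
Unshelve. all: by end_near. Qed.

Lemma integral_Phi_head x :
  (\int[mu]_(t in `]-oo, x]) (Phi t)%:E = (phi x + x * Phi x)%:E)%E.
Proof.
rewrite -[in LHS](opprK x) ge0_integration_by_substitutionNy.
- under eq_integral do rewrite /= PhiN.
  by rewrite integral_Phi_tail phiN PhiN subKr mulNr opprK.
- by apply: continuous_subspaceT; exact: continuous_Phi.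
- by move=> t _; exact: Phi_ge0.
Qed.

(** Split at [t = x], where the factor depending on [x] comes out of each half: [mills (- x)] below,
    [mills x] above. In the sum the terms in [x * Phi x * (1 - Phi x)] cancel and
    [(1 - Phi x) + Phi x] remains. *)
Lemma integral_stein x : (\int[mu]_t (stein t x)%:E = 1)%E.
Proof.
have mst : measurable_fun setT (fun t => (stein t x)%:E).
  apply/measurable_EFinP.
  exact: (measurableT_comp measurable_stein (pair2_measurable x)).
have st0 t : (0 <= (stein t x)%:E)%E by rewrite lee_fin stein_ge0.
rewrite -(itv_setU_setT false x) ge0_integral_setU//; last 2 first.
- exact: measurable_funTS.
- rewrite disj_set2E; apply/eqP; rewrite -subset0 => t []/=.
  by rewrite !in_itv/= andbT leNgt => /negP.
rewrite integral_itv_obnd_cbnd; last exact: measurable_funTS.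
have -> : (\int[mu]_(t in `]-oo, x]) (stein t x)%:E =
    (mills (- x))%:E * \int[mu]_(t in `]-oo, x]) (Phi t)%:E)%E.
  rewrite -ge0_integralZl_EFin ?mills_ge0//.
  - apply: eq_integral => t; rewrite inE/= in_itv/= => tx.
    by rewrite stein_ge// -EFinM mulrC.
  - by move=> t _; rewrite lee_fin Phi_ge0.
  - by apply: measurable_funTS; apply/measurable_EFinP; exact: measurable_Phi.
have -> : (\int[mu]_(t in `[x, +oo[) (stein t x)%:E =
    (mills x)%:E * \int[mu]_(t in `[x, +oo[) (1 - Phi t)%:E)%E.
  rewrite -ge0_integralZl_EFin ?mills_ge0//.
  - apply: eq_integral => t; rewrite inE/= in_itv/= andbT => tx.
    by rewrite stein_le// -EFinM mulrC.
  - by move=> t _; rewrite lee_fin subr_ge0 Phi_le1.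
  - apply: measurable_funTS; apply/measurable_EFinP; apply: measurable_funB => //.
    exact: measurable_Phi.
rewrite integral_Phi_head integral_Phi_tail -!EFinM -EFinD; congr EFin.
rewrite millsN /mills; field; exact: phi_neq0.
Qed.

End stein_integral.

(** * Variation of the Stein solution and its derivative *)

Section stein_variation.
Context {R : realType}.
Implicit Types x y t : R.
Local Notation mu := (@lebesgue_measure R).

Lemma measurable_steinl x : measurable_fun setT (fun t => stein t x).
Proof. exact: (measurableT_comp measurable_stein (pair2_measurable x)). Qed.

Lemma measurable_steinr t : measurable_fun setT (@stein R t).
Proof. exact: (measurableT_comp measurable_stein (pair1_measurable t)). Qed.

(** For [y <= x], monotonicity gives the difference one sign for all [t], so the absolute value
    drops and [integral_stein] evaluates both terms. *)
Lemma integral_dist_mul_stein x y :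
  (\int[mu]_t `|x * stein t x - y * stein t y|%:E = `|x - y|%:E)%E.
Proof.
wlog yx : x y / y <= x => [H|].
  have [|/ltW xy] := leP y x; first exact: H.
  rewrite (distrC x) -(H _ _ xy).
  by apply: eq_integral => t _; rewrite distrC.
have ist z : mu.-integrable setT (fun t => (stein t z)%:E).
  apply/integrableP; split.
    by apply/measurable_EFinP; exact: measurable_steinl.
  under eq_integral do rewrite gee0_abs ?lee_fin ?stein_ge0//.
  by rewrite integral_stein ltry.
have istM z : mu.-integrable setT (fun t => (z * stein t z)%:E).
  by under eq_fun do rewrite EFinM; exact: integrableZl.
have mst z : (\int[mu]_t (z * stein t z)%:E = z%:E)%E.
  by under eq_integral do rewrite EFinM; rewrite integralZl// integral_stein mule1.
under eq_integral => t _.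
  rewrite ger0_norm ?subr_ge0 ?mul_stein_nondecreasing// EFinB.
  over.
rewrite ger0_norm ?subr_ge0// EFinB -[in RHS](mst x) -[in RHS](mst y).
exact: (integralB_EFin measurableT (istM x) (istM y)).
Qed.

(** For [y <= x] the two indicators differ exactly on [[y, x[]. *)
Lemma integral_dist_step x y :
  (\int[mu]_t `|(x <= t)%R%:R - (y <= t)%R%:R|%:E = `|x - y|%:E)%E.
Proof.
wlog yx : x y / y <= x => [H|].
  have [|/ltW xy] := leP y x; first exact: H.
  rewrite (distrC x) -(H _ _ xy).
  by apply: eq_integral => t _; rewrite distrC.
transitivity (\int[mu]_t (\1_`[y, x[ t)%:E)%E.
  apply: eq_integral => t _; rewrite indicE mem_setE in_itv/=.
  have [xt|tx] := leP x t; first by rewrite (le_trans yx xt) subrr normr0.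
  by rewrite andbT sub0r normrN normr_nat.
transitivity (mu [set` `[y, x[%R]); first by rewrite integral_indic// setIT.
rewrite lebesgue_measure_itv/= lte_fin.
rewrite ger0_norm ?subr_ge0//.
have [//|] := ltP y x; rewrite le_eqVlt ltNge yx orbF => /eqP ->.
by rewrite subrr.
Qed.

(* [stein t] has a corner at [t], where Stein's equation fixes the value chosen
   here. *)
Definition stein_deriv t x : R := x * stein t x + (x <= t)%R%:R - Phi t.

(** The two branches of [stein t], each continued to the whole line, are differentiable everywhere;
    this allows the mean value theorem up to the corner from either side. *)
Let dleft t x :
  is_derive x 1 (fun z => (1 - Phi t) * mills z) ((1 - Phi t) * (1 + x * mills x)).
Proof.
have := is_deriveZ (1 - Phi t) (is_derive_mills x).
by move=> /is_derive_eq; apply.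
Qed.

Let dright t x :
  is_derive x 1 (fun z => Phi t * mills (- z)) (Phi t * (x * mills (- x) - 1)).
Proof.
have := is_deriveZ (Phi t) (is_derive1_comp (is_derive_mills (- x))
  (is_deriveN (is_derive_id x 1))).
by move=> /is_derive_eq; apply; rewrite /GRing.scale/=; ring.
Qed.

Lemma is_derive_stein t x : x != t -> is_derive x 1 (stein t) (stein_deriv t x).
Proof.
rewrite neq_lt => /orP[xt|tx].
- apply: (near_eq_is_derive _ (is_derive_eq (dleft t x) _)).
    near=> z; rewrite stein_le// ltW//; near: z; exact: lt_nbhsl.
  by rewrite /stein_deriv (ltW xt) stein_le ?(ltW xt)//= mulr1n; ring.
- apply: (near_eq_is_derive _ (is_derive_eq (dright t x) _)).
    near=> z; rewrite stein_ge// ltW//; near: z; exact: lt_nbhsr.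
  by rewrite /stein_deriv leNgt tx stein_ge ?(ltW tx)//= mulr0n; ring.
Unshelve. all: by end_near. Qed.

(** One unit comes from [x * stein t x], the other from the indicator minus [Phi t]. *)
Lemma stein_deriv_bound t x : `|stein_deriv t x| <= 2.
Proof.
rewrite /stein_deriv -addrA (le_trans (ler_normD _ _))//.
rewrite -[leRHS]/(1 + 1) lerD ?mul_stein_bound// ler_norml.
have := Phi_ge0 t; have := Phi_le1 t.
by case: (x <= t) => /= ? ?; apply/andP; split; lra.
Qed.

Lemma stein_lipschitz t x y : x <= y -> `|stein t y - stein t x| <= 2 * (y - x).
Proof.
have lhs a b : a <= b -> b <= t -> `|stein t b - stein t a| <= 2 * (b - a).
  move=> ab bt; rewrite !stein_le// ?(le_trans ab)//.
  apply: (lipschitz_is_derive _ _ _ _ _ _ ab (fun z _ => dleft t z)) => z /andP[_ zb].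
  have zt : z <= t by rewrite (le_trans (ltW zb)).
  have := stein_deriv_bound t z; rewrite /stein_deriv zt stein_le//= mulr1n.
  by congr (`|_| <= _); ring.
have rhs a b : t <= a -> a <= b -> `|stein t b - stein t a| <= 2 * (b - a).
  move=> ta ab; rewrite !stein_ge// ?(le_trans ta)//.
  apply: (lipschitz_is_derive _ _ _ _ _ _ ab (fun z _ => dright t z)) => z /andP[az _].
  have tz : t < z by rewrite (le_lt_trans ta).
  have := stein_deriv_bound t z.
  rewrite /stein_deriv (leNgt z t) tz stein_ge ?(ltW tz)//= mulr0n.
  by congr (`|_| <= _); ring.
move=> xy; have [yt|/ltW ty] := leP y t; first exact: lhs.
have [xt|/ltW tx] := leP x t; last exact: rhs.
(* When [t] separates [x] from [y], the increment is split at the corner. *)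
rewrite -(subrK (stein t t) (stein t y)) -addrA (le_trans (ler_normD _ _))//.
rewrite (le_trans (lerD (rhs _ _ (lexx t) ty) (lhs _ _ xt (lexx t))))//.
by rewrite -mulrDr addrA subrK.
Qed.

(** Admits [stein t] as a test function in [zero_biased]; [e / 2] reflects the Lipschitz constant
    [2]. *)
Lemma abs_continuous_stein t : abs_continuous (stein t).
Proof.
move=> a b e e0; exists (e / 2) => [|n x y xy _]; first by rewrite divr_gt0.
rewrite ltr_pdivlMr// mulrC mulr_sumr; apply: le_lt_trans.
by apply: ler_sum => i _; apply: stein_lipschitz; have [_ []] := xy i.
Qed.

End stein_variation.

(** * Zero biasing applied to the Stein solution *)

Section zero_bias.
Context {R : realType} {d} {T : measurableType d} {P : probability T R}.
Implicit Types (W Ws X : {RV P >-> R}) (t : R).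
Local Notation mu := (@lebesgue_measure R).

Lemma probability_bounded_integrable (f : T -> R) (k : R) :
  measurable_fun setT f -> (forall w, `|f w| <= k) ->
  P.-integrable setT (fun w => (f w)%:E).
Proof.
move=> mf fk; apply: measurable_bounded_integrable => //.
  by rewrite (le_lt_trans (probability_le1 P measurableT))// ltry.
exists k; split=> [|M kM w _]; first exact: num_real.
exact: le_trans (fk w) (ltW kM).
Qed.

Lemma measurable_natr_of_bool d' (U : measurableType d') (b : U -> bool) :
  measurable_fun setT b -> measurable_fun setT (fun u => (b u)%:R : R).
Proof.
move=> mb; rewrite (_ : (fun u => _) = (fun u => if b u then 1 else 0)).
  exact: measurable_fun_ifT.
by apply/funext => u; case: (b u).
Qed.

(** By Tonelli, the integral over [t] of [P (X = t)] is the mean Lebesgue measure of the singleton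
    [{X w}], which is [0]; a nonnegative function with zero integral vanishes almost everywhere. *)
Lemma ae_not_atom X : {ae mu, forall t, P (X @^-1` [set t]) = 0%E}.
Proof.
pose f (p : R * T) : \bar R := ((p.1 == X p.2)%R%:R)%:E.
have mX : measurable_fun setT (fun p : R * T => X p.2) by exact: measurableT_comp.
have mf : measurable_fun setT f.
  apply/measurable_EFinP/measurable_natr_of_bool.
  exact: measurable_fun_eqr.
have f0 p : (0 <= f p)%E by rewrite lee_fin.
have fE t : (\int[P]_w f (t, w) = P (X @^-1` [set t]))%E.
  transitivity (\int[P]_w (\1_(X @^-1` [set t]) w)%:E)%E; last first.
    by rewrite integral_indic// setIT.
  apply: eq_integral => w _; rewrite /f indicE/=; congr ((nat_of_bool _)%:R%:E).
  by apply/eqP/idP; rewrite inE/=.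
have mg : measurable_fun setT (fun t => P (X @^-1` [set t])).
  rewrite -(funext fE).
  exact: (measurable_fun_fubini_tonelli_F f mf f0).
have : (\int[mu]_t `|P (X @^-1` [set t])| = 0)%E.
  under eq_integral do rewrite gee0_abs// -fE.
  rewrite (fubini_tonelli (m1 := mu) (m2 := P) f mf f0).
  apply: integral0_eq => w _.
  transitivity (\int[mu]_t (\1_[set X w] t)%:E)%E.
    apply: eq_integral => t _; rewrite /f indicE/=; congr ((nat_of_bool _)%:R%:E).
    by apply/eqP/idP; rewrite inE/=.
  transitivity (mu ([set X w] `&` setT)); first exact: integral_indic.
  by rewrite setIT; exact: lebesgue_measure_set1.
move/(ae_eq_integral_abs mu measurableT mg).
by apply: filterS => t; exact.
Qed.

Lemma measurable_stein_deriv t : measurable_fun setT (@stein_deriv R t).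
Proof.
apply: measurable_funB => //; apply: measurable_funD.
  by apply: measurable_funM => //; exact: measurable_steinr.
by apply: measurable_natr_of_bool; exact: measurable_fun_ler.
Qed.

Lemma cdf_integral X t : cdf X t = (\int[P]_w ((X w <= t)%R%:R)%:E)%E.
Proof.
have mA : measurable (X @^-1` [set` `]-oo, t]%R]).
  by rewrite -[X in measurable X]setTI; exact: measurable_funP.
transitivity (\int[P]_w (\1_(X @^-1` [set` `]-oo, t]%R]) w)%:E)%E.
  by rewrite integral_indic// setIT.
apply: eq_integral => w _; rewrite indicE; congr ((nat_of_bool _)%:R%:E).
by apply/idP/idP; rewrite inE/= in_itv.
Qed.

(* [derive1 (stein t)] has a junk value at the corner [t], which [Ws] avoids almost
   surely. *)
Lemma zero_biased_stein W Ws t : 'V_P[W]%E = 1%E -> zero_biased W Ws ->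
  P (Ws @^-1` [set t]) = 0%E ->
  (\int[P]_w (W w * stein t (W w))%:E = \int[P]_w (stein_deriv t (Ws w))%:E)%E.
Proof.
move=> hvar hzb Pt0.
(* The gap [c] at the corner makes [derive1 (stein t)] an explicit function on the whole line,
   visibly measurable and bounded by [2 + |c|]. *)
pose c := derive1 (stein t) t - stein_deriv t t.
have dE x : derive1 (stein t) x = stein_deriv t x + c * (x == t)%R%:R.
  have [->|xt] := eqVneq x t; first by rewrite mulr1 /c addrC subrK.
  by rewrite mulr0 addr0 derive1E; case: (is_derive_stein t x xt).
have md : measurable_fun setT (derive1 (stein t)).
  rewrite (funext dE); apply: measurable_funD; first exact: measurable_stein_deriv.
  apply: measurable_funM => //; apply: measurable_natr_of_bool.
  exact: measurable_fun_eqr.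
have := hzb (stein t) (abs_continuous_stein t).
rewrite hvar mul1e !expectation.unlock => ->.
- apply: ae_eq_integral => //.
  + by apply/measurable_EFinP; exact: measurableT_comp.
  + apply/measurable_EFinP; apply: (measurableT_comp (measurable_stein_deriv t)) => //.
  + exists (Ws @^-1` [set t]); split => //.
    move=> w /=; apply: contra_notP => wt _.
    by rewrite dE (_ : (_ == _) = false) ?mulr0 ?addr0//; apply/eqP.
- apply: (@probability_bounded_integrable _ 1) => [|w]; last exact: mul_stein_bound.
  by apply: measurable_funM => //; apply: (measurableT_comp (measurable_steinr t)).
- apply: (@probability_bounded_integrable _ (2 + `|c|)) => [|w].
    exact: measurableT_comp.
  rewrite dE (le_trans (ler_normD _ _))// lerD ?stein_deriv_bound//.
  by rewrite normrM; case: eqP; rewrite ?normr1 ?mulr1// normr0 mulr0.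
Qed.

(** Stein's equation writes the left-hand difference as the mean of
    [stein_deriv t W - W * stein t W], and zero biasing turns the second term into
    [stein_deriv t Ws]. The constant [Phi t] then cancels, and the triangle inequality separates the
    continuous part from the jump. *)
Lemma zero_biased_cdf_dist W Ws t : 'V_P[W]%E = 1%E -> zero_biased W Ws ->
  P (Ws @^-1` [set t]) = 0%E ->
  (`|cdf W t - std_normal_cdf t| <=
   \int[P]_w (`|W w * stein t (W w) - Ws w * stein t (Ws w)|%:E +
              `|(W w <= t)%R%:R - (Ws w <= t)%R%:R|%:E))%E.
Proof.
move=> hvar hzb Pt0.
have mle X : measurable_fun setT (fun w => (X w <= t)%R%:R : R).
  by apply: measurable_natr_of_bool; exact: measurable_fun_ler.
have mst X : measurable_fun setT (fun w => X w * stein t (X w)).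
  by apply: measurable_funM => //; exact: (measurableT_comp (measurable_steinr t)).
have mg X : measurable_fun setT (fun w => stein_deriv t (X w)).
  exact: (measurableT_comp (measurable_stein_deriv t)).
have ig X : P.-integrable setT (fun w => (stein_deriv t (X w))%:E).
  by apply: (@probability_bounded_integrable _ 2) => // w; exact: stein_deriv_bound.
have -> : (cdf W t - std_normal_cdf t =
    \int[P]_w (stein_deriv t (W w) - stein_deriv t (Ws w))%:E)%E.
  transitivity (\int[P]_w (stein_deriv t (W w))%:E
      - \int[P]_w (stein_deriv t (Ws w))%:E)%E; last first.
    by rewrite -integralB_EFin//; exact: ig.
  have iS : P.-integrable setT (fun w => (W w * stein t (W w))%:E).
    by apply: (@probability_bounded_integrable _ 1) => // w; exact: mul_stein_bound.
  rewrite -(zero_biased_stein W Ws)//.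
  transitivity (\int[P]_w ((stein_deriv t (W w))%:E - (W w * stein t (W w))%:E))%E;
    last by rewrite integralB_EFin//; exact: ig.
  rewrite cdf_integral PhiE.
  transitivity (\int[P]_w (((W w <= t)%R%:R)%:E - (Phi t)%:E))%E.
    rewrite integralB_EFin//.
    - by have := expectation_cst P (Phi t); rewrite expectation.unlock => ->.
    - apply: (@probability_bounded_integrable _ 1) => // w.
      by rewrite normr_nat lern1 leq_b1.
    - exact: finite_measure_integrable_cst.
  by apply: eq_integral => w _; rewrite -!EFinB /stein_deriv; congr EFin; ring.
apply: (le_trans (le_abse_integral _ _ _)) => //.
  by apply/measurable_EFinP; exact: measurable_funB.
apply: ge0_le_integral => //.
- by apply/measurable_EFinP; apply: measurableT_comp => //; exact: measurable_funB.
- apply: emeasurable_funD; apply/measurable_EFinP;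
    by apply: measurableT_comp => //; exact: measurable_funB.
move=> w _; rewrite -EFinD lee_fin /stein_deriv.
have -> : W w * stein t (W w) + (W w <= t)%R%:R - Phi t -
    (Ws w * stein t (Ws w) + (Ws w <= t)%R%:R - Phi t) =
  (W w * stein t (W w) - Ws w * stein t (Ws w)) +
    ((W w <= t)%R%:R - (Ws w <= t)%R%:R) by ring.
exact: ler_normD.
Qed.

End zero_bias.

(** * Integration over the threshold and exchange of integrals *)

Local Open Scope ereal_scope.

Theorem theorem1p1 (R : realType) (d : measure_display) (T : measurableType d)
    (P : probability T R) (W Ws : {RV P >-> R})
    (hmean : 'E_P[W] = 0) (hvar : 'V_P[W] = 1)
    (hzb : zero_biased W Ws) :
  L1_dist (cdf W) (@std_normal_cdf R) <=
    2%:E * 'E_P[fun w => `|Ws w - W w|%R].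
Proof.
pose mu := @lebesgue_measure R.
(* [k1] carries the variation of [x * stein t x] and [k2] that of the indicator, as functions of
   threshold and outcome jointly. *)
pose k1 (p : R * T) :=
  `|W p.2 * stein p.1 (W p.2) - Ws p.2 * stein p.1 (Ws p.2)|%R%:E : \bar R.
pose k2 (p : R * T) := `|(W p.2 <= p.1)%R%:R - (Ws p.2 <= p.1)%R%:R|%R%:E : \bar R.
have m2 (X : {RV P >-> R}) : measurable_fun setT (fun p : R * T => X p.2).
  exact: measurableT_comp.
have mk1 : measurable_fun setT k1.
  have mst (X : {RV P >-> R}) :
      measurable_fun setT (fun p : R * T => X p.2 * stein p.1 (X p.2))%R.
    apply: measurable_funM => //.
    apply: (measurableT_comp (f := fun p : R * R => stein p.1 p.2)
      (g := fun p : R * T => (p.1, X p.2)) measurable_stein).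
    exact: measurable_fun_pair.
  by apply/measurable_EFinP/measurableT_comp => //; exact: measurable_funB.
have mk2 : measurable_fun setT k2.
  have mle (X : {RV P >-> R}) :
      measurable_fun setT (fun p : R * T => (X p.2 <= p.1)%R%:R : R).
    by apply: measurable_natr_of_bool; exact: measurable_fun_ler.
  by apply/measurable_EFinP/measurableT_comp => //; exact: measurable_funB.
have mk : measurable_fun setT (k1 \+ k2) by exact: emeasurable_funD.
have k0 p : 0 <= (k1 \+ k2) p by rewrite adde_ge0// lee_fin.
have mPhi : measurable_fun setT (@std_normal_cdf R).
  by rewrite (funext (@PhiE R)); apply/measurable_EFinP; exact: measurable_Phi.
apply: (@le_trans _ _ (\int[mu]_t \int[P]_w (k1 \+ k2) (t, w))).
  apply: ae_ge0_le_integral => //.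
  - apply: measurableT_comp => //; apply: emeasurable_funB => //.
    exact: cdf_measurable.
  - by move=> t _; apply: integral_ge0.
  - exact: (measurable_fun_fubini_tonelli_F (k1 \+ k2) mk k0).
  (* The pointwise bound is available only off the atoms of [Ws], a Lebesgue-null set of
     thresholds. *)
  - have := ae_not_atom Ws; apply: filterS; first exact: (ae_filter_ringOfSetsType mu).
    move=> t Pt0 _; exact: zero_biased_cdf_dist.
rewrite (fubini_tonelli (m1 := mu) (m2 := P) (k1 \+ k2) mk k0).
(* With the outcome fixed, [k1] and [k2] each integrate to [|W w - Ws w|]; this is the source of the
   factor [2]. *)
have kE w : \int[mu]_t (k1 \+ k2) (t, w) = 2%:E * `|Ws w - W w|%R%:E.
  transitivity (\int[mu]_t k1 (t, w) + \int[mu]_t k2 (t, w)).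
    have mkw (k : R * T -> \bar R) : measurable_fun setT k ->
        measurable_fun setT (fun t => k (t, w)).
      by move=> mk'; apply: (measurableT_comp mk'); exact: pair2_measurable.
    apply: ge0_integralD => //;
      by [exact: mkw mk1|exact: mkw mk2|move=> t _; rewrite lee_fin].
  have -> : \int[mu]_t k1 (t, w) = `|W w - Ws w|%R%:E.
    exact: (integral_dist_mul_stein (W w) (Ws w)).
  have -> : \int[mu]_t k2 (t, w) = `|W w - Ws w|%R%:E.
    exact: (integral_dist_step (W w) (Ws w)).
  by rewrite (distrC (Ws w)) -EFinD -EFinM mulr_natl mulr2n.
under eq_integral => w _ do rewrite kE.
rewrite expectation.unlock ge0_integralZl_EFin//.
by apply/measurable_EFinP/measurableT_comp => //; exact: measurable_funB.
Qed.
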